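(* For all constants $L\ge 1$ and $A\ge 0$ there exist constants $L',A'$, depending only on $L$ and $A$, such that the following holds. Let $U$ be an arbitrary group and let $\rho_0$ be an action of $U$ on $\mathbb{Z}$ by $(L,A)$-quasi-isometries. Then there are an isometric action $\rho_1$ of $U$ on $\mathbb{Z}$ and a surjective $(L',A')$-quasi-isometry $f:\mathbb{Z}\to\mathbb{Z}$ that is equivariant, i.e. $f(\rho_0(u)(n))=\rho_1(u)(f(n))$ for all $u\in U$ and $n\in\mathbb{Z}$.
   Context: $\mathbb{Z}$ carries its standard metric $d(m,n)=|m-n|$. An action by $(L,A)$-quasi-isometries is a genuine group action (each $u\in U$ acts by a bijection $\rho_0(u)$ and $\rho_0$ is a homomorphism) such that each $\rho_0(u)$ is an $(L,A)$-quasi-isometry, i.e. $L^{-1}d(x,y)-A\le d(\rho_0(u)x,\rho_0(u)y)\le L\,d(x,y)+A$ for all $x,y$ (coarse surjectivity being automatic). *)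

(* Defs.v *)
From HB Require Import structures.
From mathcomp Require Import all_boot all_order all_algebra.
From mathcomp Require Import reals.

Set Implicit Arguments.
Unset Strict Implicit.
Unset Printing Implicit Defensive.

Import Order.TTheory GRing.Theory Num.Theory.

Local Open Scope ring_scope.

Definition zdist (m n : int) : int := `|m - n|.

(* The coarse surjectivity usually required of a quasi-isometry is left out:
   this predicate is only applied to bijections and to surjections. *)
Definition quasi_isometry (R : realType) (L A : R) (f : int -> int) : Prop :=
  forall x y : int,
    L^-1 * (zdist x y)%:~R - A <= (zdist (f x) (f y))%:~R
    /\ (zdist (f x) (f y))%:~R <= L * (zdist x y)%:~R + A.

Definition isometry (f : int -> int) : Prop :=
  forall x y : int, zdist (f x) (f y) = zdist x y.

Definition surjective (f : int -> int) : Prop :=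
  forall m : int, exists n : int, f n = m.

(* Left actions. That [rho 1] is the identity follows, an idempotent bijection
   being the identity. *)
Definition is_action (U : groupType) (rho : U -> int -> int) : Prop :=
  (forall u : U, bijective (rho u))
  /\ (forall (u v : U) (n : int), rho (u * v)%g n = rho u (rho v n)).

Definition quasi_isometric_action (R : realType) (L A : R) (U : groupType)
    (rho : U -> int -> int) : Prop :=
  is_action rho /\ forall u : U, quasi_isometry L A (rho u).

Definition isometric_action (U : groupType) (rho : U -> int -> int) : Prop :=
  is_action rho /\ forall u : U, isometry (rho u).

(* Main.v *)
From mathcomp Require Import boolp classical_sets fsbigop.
Require Import Defs.
From HB Require Import structures.
From mathcomp Require Import all_boot all_order all_algebra.
From mathcomp Require Import reals.
From mathcomp Require Import zify lra.

Set Implicit Arguments.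
Unset Strict Implicit.
Unset Printing Implicit Defensive.

Import Order.TTheory GRing.Theory Num.Theory.

Local Open Scope ring_scope.

(** A quasi-isometry of the integers moves neighbours by a bounded amount and
    separates points at a definite distance K, so it either preserves or
    reverses the order of all pairs of points at distance at least K: it has
    a direction e = 1 or e = -1 ([coarse_directionP]).

    For bijections more is true. With [cut a] the step function equal to 1 up
    to a and to -1 beyond a, the function x |-> cut 0 x - e * cut 0 (u x)
    has finite support; call its sum the flux of u. Reindexing the sum by a
    bijection makes the flux a crossed homomorphism ([flux_comp]). Moving the
    cuts from 0 to p and u p changes the sum by an explicit affine amount and
    leaves one of size at most 2 * K, so that 2 * u p is within 2 * K of
    e * (2 * p) + e * flux ([flux_bound]). Hence u |-> (y |-> e u * y + b u),
    b u := e u * flux, is an isometric action that rho0 follows at bounded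
    distance, after doubling the scale ([near_isometric_action]). Bijectivity
    is what makes the action exact: the displacements of coarsely monotone
    maps form only a quasimorphism in general.

    Next, the bounded set of all e u * (2 * rho0 u x - b u), i.e. the points
    of the orbit of x pulled back by the isometric action, depends
    equivariantly on x, hence so does the sum F x of its minimum and maximum
    ([equivariant_midrange]); unlike the maximum alone, it is compatible with
    reflections. So F intertwines rho0 with y |-> e u * y + 2 * b u, and F x
    is at bounded distance from 4 * x.

    The image M of F is invariant and relatively dense, but it may have gaps.
    Counting points of M identifies it with the integers in an
    order-preserving way, and a monotone or antitone bijection of the integers
    is an isometry, so the action on M becomes isometric on the integers
    ([collapse_action]). The map sought is F followed by this counting. All
    constants depend on the gap K only, that is, on L and A. *)

(** * Coarse direction *)

(** Both inequalities of a quasi-isometry with a single integral constant, so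
    that linear integer arithmetic applies. *)
Definition coarse (c : int) (u : int -> int) : Prop :=
  forall x y : int, zdist (u x) (u y) <= c * (zdist x y + 1)
                      /\ zdist x y <= c * (zdist (u x) (u y) + 1).

Definition coarse_direction (K : int) (u : int -> int) (e : int) : Prop :=
  (e = 1 \/ e = -1) /\ forall x y : int, x + K <= y -> 0 < e * (u y - u x).

(** Points this far apart have images more than 2 * c apart, whereas
    neighbours have images at most 2 * c apart. *)
Definition coarse_gap (c : int) : int := c * (2 * c + 1) + 1.

Lemma coarse_gap_ge0 (c : int) : 1 <= c -> 0 <= coarse_gap c.
Proof. by rewrite /coarse_gap; nia. Qed.

(** On the pairs (x, y) with x + K <= y the difference u y - u x exceeds 2 * c
    in absolute value and changes by at most 2 * c when x or y moves by one
    step. It cannot jump over 0, and any two such pairs are joined by steps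
    that increase y and decrease x. *)
Lemma coarse_directionP (c : int) (u : int -> int) :
  1 <= c -> coarse c u -> exists e, coarse_direction (coarse_gap c) u e.
Proof.
move=> c1 cu; move: {-1}(coarse_gap c) (erefl (coarse_gap c)) => K KE.
have step (x : int) : `|u (x + 1) - u x| <= 2 * c.
  by have := (cu (x + 1) x).1; rewrite /zdist; lia.
have far (x y : int) : x + K <= y -> 2 * c < `|u y - u x|.
  move=> xy; rewrite ltNge; apply/negP => small.
  have := (cu y x).2; rewrite /zdist.
  have : c * (`|u y - u x| + 1) <= c * (2 * c + 1) by rewrite ler_pM2l; lia.
  by rewrite -KE /coarse_gap in xy; lia.
have [e [e1 base]] : exists e : int, (e = 1 \/ e = -1) /\ 0 < e * (u K - u 0).
  have := far 0 K; rewrite add0r lexx => /(_ isT) H.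
  by have [h|h] := ltP 0 (u K - u 0); [exists 1|exists (-1)]; lia.
have down (x y : int) : x + K <= y ->
    0 < e * (u y - u x) <-> 0 < e * (u y - u (x - 1)).
  move=> xy; have := step (x - 1); rewrite subrK => s.
  have := far x y xy; have := far (x - 1) y ltac:(lia).
  by case: e1 => ->; split; lia.
have up (x y : int) : x + K <= y ->
    0 < e * (u y - u x) <-> 0 < e * (u (y + 1) - u x).
  move=> xy; have := step y => s.
  have := far x y xy; have := far x (y + 1) ltac:(lia).
  by case: e1 => ->; split; lia.
have grow (x y : int) (m n : nat) : x + K <= y ->
    0 < e * (u y - u x) <-> 0 < e * (u (y + m%:Z) - u (x - n%:Z)).
  move=> xy; elim: n => [|n IHn].
    rewrite subr0; elim: m => [|m IHm]; first by rewrite addr0.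
    rewrite (_ : y + m.+1%:Z = y + m%:Z + 1); last by lia.
    by apply: iff_trans IHm _; apply: up; lia.
  rewrite (_ : x - n.+1%:Z = x - n%:Z - 1); last by lia.
  by apply: iff_trans IHn _; apply: down; lia.
exists e; split=> // x y xy.
pose N : int := `|x| + `|y| + `|K|.
(* Both (x, y) and (0, K) widen to the pair (- N, K + N). *)
apply: (grow x y (absz (K + N - y)%R) (absz (x + N)%R) xy).2.
rewrite (_ : y + _ = K + N) 1?(_ : x - _ = 0 - N); try by rewrite /N; lia.
have := (grow 0 K (absz N) (absz N) ltac:(lia)).1 base.
by rewrite (_ : (absz N)%:Z = N) //; rewrite /N; lia.
Qed.

(** * Sums over the integers of finitely supported functions *)

Definition fin_supp (F : int -> int) : Prop :=
  exists r : seq int, forall x, x \notin r -> F x = 0.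

Definition zsum (F : int -> int) : int := \sum_(x \in [set: int]%classic) F x.

Lemma zsum_seq (r : seq int) (F : int -> int) :
  uniq r -> (forall x, x \notin r -> F x = 0) -> zsum F = \sum_(x <- r) F x.
Proof.
move=> ur Fr; rewrite /zsum (@fsbigE _ _ _ _ _ r) //;
  last by move=> x _; exact: Fr.
by apply: eq_bigl => x; rewrite classical_sets.in_setT.
Qed.

Lemma fin_supp2 (F G : int -> int) : fin_supp F -> fin_supp G ->
  exists r : seq int, uniq r
    /\ forall x, x \notin r -> F x = 0 /\ G x = 0.
Proof.
move=> [r Fr] [s Gs]; exists (undup (r ++ s)); split; first exact: undup_uniq.
by move=> x; rewrite mem_undup mem_cat negb_or => /andP[/Fr -> /Gs ->].
Qed.

Lemma fin_suppD (F G : int -> int) :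
  fin_supp F -> fin_supp G -> fin_supp (fun x => F x + G x).
Proof.
move=> fF fG; have [r [_ FG]] := fin_supp2 fF fG.
by exists r => x /FG[-> ->]; rewrite addr0.
Qed.

Lemma fin_suppZ (k : int) (F : int -> int) :
  fin_supp F -> fin_supp (fun x => k * F x).
Proof. by move=> [r Fr]; exists r => x /Fr ->; rewrite mulr0. Qed.

Lemma fin_supp_reindex (u : int -> int) (F : int -> int) :
  bijective u -> fin_supp F -> fin_supp (F \o u).
Proof.
move=> [w uK wK] [r Fr]; exists [seq w y | y <- r] => x xr /=.
by apply: Fr; apply: contra xr => uxr; apply/mapP; exists (u x).
Qed.

Lemma fin_supp_near (p n : int) (F : int -> int) :
  (forall x : int, n <= `|x - p| -> F x = 0) -> fin_supp F.
Proof.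
move=> F0; exists [seq p - n + i%:Z | i <- iota 0 (absz (2 * n + 1)%R)] => x xr.
apply: F0; rewrite leNgt; apply: contra xr => xn; apply/mapP.
by exists (absz (x - (p - n))%R); rewrite ?mem_iota; lia.
Qed.

Lemma zsumD (F G : int -> int) : fin_supp F -> fin_supp G ->
  zsum (fun x => F x + G x) = zsum F + zsum G.
Proof.
move=> fF fG; have [r [ur FG]] := fin_supp2 fF fG.
rewrite !(@zsum_seq r) ?big_split // => x /FG[F0 G0] //.
by rewrite F0 G0 addr0.
Qed.

Lemma zsumZ (k : int) (F : int -> int) : fin_supp F ->
  zsum (fun x => k * F x) = k * zsum F.
Proof.
move=> fF; have [r [ur FG]] := fin_supp2 fF fF.
rewrite !(@zsum_seq r) ?mulr_sumr // => x /FG[F0 _] //.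
by rewrite F0 mulr0.
Qed.

Lemma ler_zsum (F G : int -> int) : fin_supp F -> fin_supp G ->
  (forall x, F x <= G x) -> zsum F <= zsum G.
Proof.
move=> fF fG FG; have [r [ur r0]] := fin_supp2 fF fG.
by rewrite !(@zsum_seq r) ?ler_sum // => x /r0[].
Qed.

Lemma zsum_reindex (u : int -> int) (F : int -> int) :
  bijective u -> zsum (F \o u) = zsum F.
Proof. by move=> bu; rewrite /zsum [RHS](reindex_fsbigT u). Qed.

(** * Flux *)

(** The values 1 and -1, rather than 1 and 0, make a reversal of the line act
    as a change of sign. *)
Definition cut (a x : int) : int := if x <= a then 1 else -1.

Lemma fin_supp_cutB (a b : int) : fin_supp (fun x => cut a x - cut b x).
Proof.
apply: (@fin_supp_near 0 (`|a| + `|b| + 1)) => x; rewrite subr0 /cut => xab.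
by case: (leP x a); case: (leP x b); lia.
Qed.

Lemma zsum_cutB (a b : int) : zsum (fun x => cut a x - cut b x) = 2 * (a - b).
Proof.
have ge : forall a b, b <= a -> zsum (fun x => cut a x - cut b x) = 2 * (a - b).
  move=> {}a {}b ab; have -> : a = b + (absz (a - b)%R) by lia.
  elim: (absz _) => [|n IH].
    by rewrite addr0 (@zsum_seq [::]) ?big_nil; [lia| |move=> x _; lia].
  rewrite (_ : b + n.+1%:Z = b + n%:Z + 1); last by lia.
  move: (b + n%:Z) IH => {ab}a IH.
  transitivity (zsum (fun x =>
    (cut (a + 1) x - cut a x) + (cut a x - cut b x))).
    by congr zsum; apply/funext => x; lia.
  rewrite zsumD ?IH; try exact: fin_supp_cutB.
  rewrite (@zsum_seq [:: a + 1]) //.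
    by rewrite big_seq1 /cut lexx; case: (leP (a + 1) a); lia.
  by move=> x; rewrite inE /cut; case: (leP x a); case: (leP x (a + 1)); lia.
have [/ge//|ab] := leP b a.
transitivity (zsum (fun x => -1 * (cut b x - cut a x))).
  by congr zsum; apply/funext => x; lia.
by rewrite zsumZ ?ge; [lia|lia|exact: fin_supp_cutB].
Qed.

(** For e = 1 this is twice the number of integers that u carries from the
    half-line x <= 0 to its complement, minus twice the number carried back. *)
Definition flux (e : int) (u : int -> int) : int :=
  zsum (fun x => cut 0 x - e * cut 0 (u x)).

Section Flux.
Variables (K : int) (u : int -> int) (e : int).
Hypotheses (K0 : 0 <= K) (bu : bijective u) (du : coarse_direction K u e).

(** Beyond distance K from p the direction decides on which side of u p the
    point u x lies; the two bounding cuts allow either answer in between. *)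
Lemma cut_sandwich (p x : int) :
  cut (p - K) x <= e * cut (u p) (u x) <= cut (p + K) x.
Proof.
have [e1 mono] := du; have := mono x p; have := mono p x.
rewrite /cut; case: (leP x (p - K)); case: (leP x (p + K));
  case: (leP (u x) (u p)); case: e1 => ->; lia.
Qed.

Lemma fin_supp_cut_defect (p : int) :
  fin_supp (fun x => cut p x - e * cut (u p) (u x)).
Proof.
apply: (@fin_supp_near p (K + 1)) => x xp.
have := cut_sandwich p x; rewrite /cut.
by case: (leP x (p - K)); case: (leP x (p + K)); case: (leP x p); lia.
Qed.

Lemma cut_defect_bound (p : int) :
  `|zsum (fun x => cut p x - e * cut (u p) (u x))| <= 2 * K.
Proof.
have fd := fin_supp_cut_defect p.
have h1 := ler_zsum fd (fin_supp_cutB p (p - K)).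
have h2 := ler_zsum (fin_supp_cutB p (p + K)) fd.
rewrite !zsum_cutB in h1 h2.
have lo : zsum (fun x => cut p x - e * cut (u p) (u x)) <= 2 * (p - (p - K)).
  by apply: h1 => x; have := cut_sandwich p x; lia.
have hi : 2 * (p - (p + K)) <= zsum (fun x => cut p x - e * cut (u p) (u x)).
  by apply: h2 => x; have := cut_sandwich p x; lia.
lia.
Qed.

(** Transporting the cut from 0 to p in the source and from 0 to u p in the
    target; the sums of the outer terms are known exactly. *)
Lemma flux_split (p : int) (F1 := fun x => cut 0 x - cut p x)
    (F2 := fun x => cut p x - e * cut (u p) (u x))
    (F3 := (fun y => cut (u p) y - cut 0 y) \o u) :
  (fun x => cut 0 x - e * cut 0 (u x)) = (fun x => F1 x + (F2 x + e * F3 x)).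
Proof. by apply/funext => x; rewrite /F1 /F2 /F3 /=; lia. Qed.

Lemma fin_supp_flux : fin_supp (fun x => cut 0 x - e * cut 0 (u x)).
Proof.
rewrite (flux_split 0); apply: fin_suppD; first exact: fin_supp_cutB.
apply: fin_suppD; first exact: fin_supp_cut_defect.
by apply: fin_suppZ; apply: fin_supp_reindex => //; exact: fin_supp_cutB.
Qed.

(** A bijection with coarse direction e stays at bounded distance from the
    isometry determined by its flux, uniformly in the bijection. The factor 2
    comes from the two values of [cut] differing by 2. *)
Lemma flux_bound (p : int) : `|2 * u p - (e * (2 * p) + e * flux e u)| <= 2 * K.
Proof.
have f3 : fin_supp ((fun y => cut (u p) y - cut 0 y) \o u).
  by apply: fin_supp_reindex => //; exact: fin_supp_cutB.
have f2 := fin_supp_cut_defect p.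
have f3e := fin_suppZ e f3.
rewrite /flux (flux_split p) zsumD; [|exact: fin_supp_cutB|exact: fin_suppD].
rewrite (zsumD f2 f3e) (zsumZ e f3) zsum_reindex // !zsum_cutB.
by have := cut_defect_bound p; case: du => -[] -> _; lia.
Qed.

End Flux.

(** The defect of u \o v is the defect of v plus e' times the defect of u
    moved by v, and summation is invariant under the bijection v. *)
Lemma flux_comp (K : int) (u v : int -> int) (e e' : int) :
  0 <= K -> bijective u -> bijective v ->
  coarse_direction K u e -> coarse_direction K v e' ->
  flux (e * e') (u \o v) = flux e' v + e' * flux e u.
Proof.
move=> K0 bu bv du dv.
have fu := fin_supp_flux K0 bu du; have fv := fin_supp_flux K0 bv dv.
have fuv := fin_supp_reindex bv fu.
rewrite /flux -[in e' * _](zsum_reindex _ bv).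
rewrite -(zsumZ _ fuv) -(zsumD fv (fin_suppZ _ fuv)).
by congr zsum; apply/funext => x /=; lia.
Qed.

(** Tested on one pair so far apart that v keeps it K apart. *)
Lemma coarse_direction_comp (c K : int) (u v : int -> int) (e e' d : int) :
  1 <= c -> 0 <= K -> coarse c v ->
  coarse_direction K u e -> coarse_direction K v e' ->
  coarse_direction K (u \o v) d -> d = e * e'.
Proof.
move=> c1 K0 cv [e1 mu] [e1' mv] [d1 muv].
pose y := c * (K + 1) + K.
have y0 : 0 + K <= y by rewrite /y; nia.
have far : K <= `|v y - v 0|.
  have := (cv y 0).2; rewrite /zdist subr0 => h.
  rewrite leNgt; apply/negP => small.
  have : c * (`|v y - v 0| + 1) <= c * (K + 1) by rewrite ler_pM2l; lia.
  by rewrite /y in h y0 *; nia.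
have := mv 0 y y0; have := muv 0 y y0.
have := mu (v 0) (v y); have := mu (v y) (v 0); move: far => /=.
by case: e1 => ->; case: e1' => ->; case: d1 => ->; lia.
Qed.

(** * A nearby isometric action *)

(** The maps y |-> e u * y + b u form an isometric action, which [rho] follows
    on the doubled line. *)
Lemma near_isometric_action (c : int) (U : groupType) (rho : U -> int -> int) :
  1 <= c -> is_action rho -> (forall u, coarse c (rho u)) ->
  exists e b : U -> int,
    [/\ forall u, e u = 1 \/ e u = -1,
        forall u v, e (u * v)%g = e u * e v,
        forall u v, b (u * v)%g = b u + e u * b v
      & forall u x, `|2 * rho u x - (e u * (2 * x) + b u)| <= 2 * coarse_gap c].
Proof.
move=> c1 arho crho.
have K0 := coarse_gap_ge0 c1.
have [e de] := choice (fun u => coarse_directionP c1 (crho u)).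
have rhoM u v : rho (u * v)%g = rho u \o rho v.
  by apply/funext => x; rewrite arho.2.
have eM u v : e (u * v)%g = e u * e v.
  apply: (coarse_direction_comp c1 K0 (crho v) (de u) (de v)).
  by rewrite -rhoM.
exists e, (fun u => e u * flux (e u) (rho u)); split => // [u|u v|u x].
- exact: (de u).1.
- rewrite eM rhoM (flux_comp K0 (arho.1 u) (arho.1 v) (de u) (de v)).
  by case: (de v).1 => ->; lia.
- exact: flux_bound (arho.1 u) (de u) x.
Qed.

(** * Equivariant midranges *)

(** Twice the midpoint, which is always an integer. *)
Definition midrange (S : int -> Prop) (m : int) : Prop :=
  exists lo hi : int,
    [/\ S lo, S hi, forall z, S z -> lo <= z <= hi & m = lo + hi].

Lemma bounded_has_max (S : int -> Prop) (a b : int) :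
  (exists z, S z) -> (forall z, S z -> a <= z <= b) ->
  exists2 m, S m & forall z, S z -> z <= m.
Proof.
move=> [z0 Sz0] Sab.
pose P (n : nat) := `[< S (a + n%:Z) >].
have exP : exists n, P n.
  exists (absz (z0 - a)%R); apply/asboolP.
  by rewrite (_ : a + _ = z0) //; have := Sab _ Sz0; lia.
have bP n : P n -> (n <= absz (b - a)%R)%N by move/asboolP/Sab; lia.
case: (ex_maxnP exP bP) => n /asboolP Sn maxn; exists (a + n%:Z) => // z Sz.
have := Sab _ Sz => az.
have : P (absz (z - a)%R) by apply/asboolP; rewrite (_ : a + _ = z) //; lia.
by move/maxn; lia.
Qed.

Lemma midrange_exists (S : int -> Prop) (a b : int) :
  (exists z, S z) -> (forall z, S z -> a <= z <= b) -> exists m, midrange S m.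
Proof.
move=> [z0 Sz0] Sab.
have [|hi Shi hiP] := bounded_has_max _ Sab; first by exists z0.
(* The minimum, as the maximum of the reflected set. *)
have [||lo Slo loP] := @bounded_has_max (fun z => S (- z)) (- b) (- a).
- by exists (- z0); rewrite opprK.
- by move=> z /Sab; lia.
exists (- lo + hi), (- lo), hi; split => // z Sz.
have := hiP z Sz; have := loP (- z); rewrite opprK => /(_ Sz); lia.
Qed.

Lemma midrange_affine (S T : int -> Prop) (e b m m' : int) :
  e = 1 \/ e = -1 -> (forall z, T z <-> S (e * (z - b))) ->
  midrange S m -> midrange T m' -> m' = e * m + 2 * b.
Proof.
move=> e1 TS [lo [hi [Slo Shi SP ->]]] [lo' [hi' [Tlo Thi TP ->]]].
have ST z : S z -> T (e * z + b).
  move=> Sz; apply/TS; rewrite (_ : e * _ = z) //.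
  by case: e1 => ->; lia.
have := TP _ (ST _ Slo); have := TP _ (ST _ Shi).
have := SP _ ((TS _).1 Tlo); have := SP _ ((TS _).1 Thi).
by case: e1 => ->; lia.
Qed.

(** The crossed homomorphism identity for [b] says that the pulled back orbit
    of [rho v x] is the image under y |-> e v * y + b v of that of [x]. *)
Lemma equivariant_midrange (K : int) (U : groupType) (rho : U -> int -> int)
    (e b : U -> int) :
  is_action rho ->
  (forall u, e u = 1 \/ e u = -1) ->
  (forall u v, e (u * v)%g = e u * e v) ->
  (forall u v, b (u * v)%g = b u + e u * b v) ->
  (forall u x, `|2 * rho u x - (e u * (2 * x) + b u)| <= 2 * K) ->
  exists F : int -> int,
    (forall u x, F (rho u x) = e u * F x + 2 * b u)
    /\ forall x, `|F x - 4 * x| <= 4 * K.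
Proof.
move=> arho e1 eM bM near.
pose S x (z : int) := exists u, z = e u * (2 * rho u x - b u).
have Snear x z : S x z -> 2 * x - 2 * K <= z <= 2 * x + 2 * K.
  by move=> [u ->]; have := near u x; case: (e1 u) => ->; lia.
have Sne x : exists z, S x z by exists (e 1%g * (2 * rho 1%g x - b 1%g)), 1%g.
have SM v x z : S (rho v x) z <-> S x (e v * (z - b v)).
  split=> [[u ->]|[w zE]].
    exists (u * v)%g; rewrite eM bM arho.2.
    by case: (e1 u) => ->; case: (e1 v) => ->; lia.
  exists (w * v^-1)%g.
  have eW : e w = e (w * v^-1)%g * e v by rewrite -eM mulgVK.
  have bW : b w = b (w * v^-1)%g + e (w * v^-1)%g * b v by rewrite -bM mulgVK.
  have rW : rho w x = rho (w * v^-1)%g (rho v x) by rewrite -arho.2 mulgVK.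
  move: zE; rewrite eW bW rW.
  by case: (e1 (w * v^-1)%g) => ->; case: (e1 v) => ->; lia.
have [F FP] := choice (fun x => midrange_exists (Sne x) (Snear x)).
exists F; split=> [u x|x].
  exact: midrange_affine (e1 u) (SM u x) (FP x) (FP _).
have [lo [hi [Slo Shi _ ->]]] := FP x.
by have := Snear _ _ Slo; have := Snear _ _ Shi; lia.
Qed.

(** * Collapsing a relatively dense subset onto the integers *)

(** The number of points of M in the interval from 0 (included) to y
    (excluded), counted negatively when y < 0. *)
Definition rank (M : int -> bool) (y : int) : int :=
  match y with
  | Posz n => \sum_(i < n) (M i%:Z : nat)%:Z
  | Negz n => - \sum_(i < n.+1) (M (- i.+1%:Z) : nat)%:Z
  end.

Lemma rankS (M : int -> bool) (y : int) :
  rank M (y + 1) = rank M y + (M y : nat)%:Z.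
Proof.
case: y => [n|[|n]].
- by rewrite (_ : Posz n + 1 = Posz n.+1) /= ?big_ord_recr // addrC.
- by rewrite (_ : Negz 0 + 1 = Posz 0) //= big_ord0 big_ord1 NegzE addNr.
- rewrite (_ : Negz n.+1 + 1 = Negz n) /=; last by lia.
  by rewrite [in RHS]big_ord_recr /= NegzE opprD addrNK.
Qed.

Lemma rank_nat (M : int -> bool) (y : int) (n : nat) :
  rank M y <= rank M (y + n%:Z) <= rank M y + n%:Z.
Proof.
elim: n => [|n IHn]; first by rewrite !addr0 lexx.
rewrite (_ : y + n.+1%:Z = y + n%:Z + 1) ?rankS; last by lia.
by case: (M _); lia.
Qed.

Lemma rank_le (M : int -> bool) (y z : int) :
  y <= z -> rank M y <= rank M z <= rank M y + (z - y).
Proof.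
move=> yz; have := rank_nat M y (absz (z - y)%R).
by rewrite (_ : y + _ = z); lia.
Qed.

Lemma rank_lt (M : int -> bool) (m z : int) :
  M m -> m < z -> rank M m < rank M z.
Proof.
move=> Mm mz; have := @rank_le M (m + 1) z; rewrite rankS Mm; lia.
Qed.

Section Collapse.
Variables (M : int -> bool) (D : int).
Hypotheses (D1 : 1 <= D)
  (Mdense : forall y : int, exists m : int, M m /\ y <= m < y + D).

Lemma rank_period (y : int) (n : nat) :
  rank M y + n%:Z <= rank M (y + D * n%:Z).
Proof.
elim: n => [|n IHn]; first by rewrite mulr0 !addr0.
have [m [Mm mP]] := Mdense (y + D * n%:Z).
have := @rank_lt M m (y + D * n.+1%:Z) Mm; have := @rank_le M (y + D * n%:Z) m.
lia.
Qed.

Lemma rank_expand (y z : int) :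
  y <= z -> z - y <= D * (rank M z - rank M y + 1).
Proof.
move=> yz; pose n := absz ((z - y) %/ D)%Z.
have D0 : D != 0 by lia.
have nE : n%:Z = ((z - y) %/ D)%Z by rewrite /n gez0_abs // divz_ge0; lia.
have zE := divz_eq (z - y) D; have rlt := ltz_mod (z - y) D0.
have := modz_ge0 (z - y) D0; rewrite -nE in zE => r0.
have h1 := rank_period y n.
have h2 := @rank_le M (y + D * n%:Z) z.
have h3 : n%:Z <= rank M z - rank M y by lia.
have : D * n%:Z <= D * (rank M z - rank M y) by rewrite ler_pM2l; lia.
lia.
Qed.

(** Discrete intermediate values: the rank grows by at most 1 at each step,
    and it grows only when leaving a point of M. *)
Lemma rank_onto (j : int) : exists m, M m /\ rank M m = j.
Proof.
have lo n : rank M (- (D * n%:Z)) <= rank M 0 - n%:Z.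
  by have := rank_period (- (D * n%:Z)) n; rewrite addNr lerBrDr.
have hi n := rank_period 0 n.
have [N NP] : exists N : nat, `|j| + `|rank M 0| < N%:Z.
  by exists (absz (`|j| + `|rank M 0| + 1)%R); lia.
have cross (n : nat) (y : int) : rank M y <= j -> j < rank M (y + n%:Z) ->
    exists m : int, M m /\ rank M m = j.
  elim: n y => [|n IHn] y yj; first by rewrite addr0 ltNge yj.
  have [jy|jy] := ltP j (rank M (y + 1)).
    by move: jy; rewrite rankS; case My: (M y); [exists y; split=> // |]; lia.
  rewrite (_ : y + n.+1%:Z = y + 1 + n%:Z); last by lia.
  exact: IHn.
apply: (cross (absz (2 * D * N%:Z)%R) (- (D * N%:Z))).
  by have := lo N; lia.
rewrite (_ : _ + _ = 0 + D * N%:Z); last by nia.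
by apply: lt_le_trans (hi N); lia.
Qed.

Lemma enumeration_exists : exists en : int -> int,
  [/\ forall j, M (en j), cancel en (rank M),
      forall m, M m -> en (rank M m) = m
    & forall i j : int, i < j -> en i < en j].
Proof.
have [en enP] := choice rank_onto.
exists en; split=> [j|j|m Mm|i j ij]; first exact: (enP j).1.
- exact: (enP j).2.
- have [Me re] := enP (rank M m).
  have [lt|lt|//] := ltgtP (en (rank M m)) m.
    by have := rank_lt Me lt; rewrite re ltxx.
  by have := rank_lt Mm lt; rewrite re ltxx.
- rewrite ltNge; apply/negP => ji.
  by have := rank_le M ji; rewrite !(enP _).2; lia.
Qed.

End Collapse.

Lemma monotone_expands (g : int -> int) (e : int) :
  (e = 1 \/ e = -1) -> (forall i j : int, i < j -> 0 < e * (g j - g i)) ->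
  forall x y : int, zdist x y <= zdist (g x) (g y).
Proof.
move=> e1 mono.
have nat_step (x : int) (n : nat) : n%:Z <= e * (g (x + n%:Z) - g x).
  elim: n => [|n IHn]; first by rewrite addr0 subrr mulr0.
  have := mono (x + n%:Z) (x + n.+1%:Z).
  by case: e1 IHn => ->; lia.
have le (x y : int) : x <= y -> y - x <= e * (g y - g x).
  move=> xy; have := nat_step x (absz (y - x)%R).
  by rewrite (_ : x + _ = y); lia.
move=> x y; rewrite /zdist.
by have [xy|/ltW xy] := leP x y; have := le _ _ xy; case: e1 => ->; lia.
Qed.

(** The action is transported by [rank], which restricts to an order
    isomorphism from M to the integers. Each transported map and its inverse
    are strictly monotone or antitone, hence do not decrease distances. *)
Lemma collapse_action (D : int) (U : groupType) (M : int -> bool)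
    (e b : U -> int) :
  1 <= D -> (forall y : int, exists m : int, M m /\ y <= m < y + D) ->
  (forall u, e u = 1 \/ e u = -1) ->
  (forall u m, M m -> M (e u * m + b u)) ->
  (forall u v, e (u * v)%g = e u * e v) ->
  (forall u v, b (u * v)%g = b u + e u * b v) ->
  exists rho1 : U -> int -> int,
    isometric_action rho1
    /\ forall u m, M m -> rank M (e u * m + b u) = rho1 u (rank M m).
Proof.
move=> D1 Mdense e1 Minv eM bM.
have [en [Men enK rankK en_lt]] := enumeration_exists D1 Mdense.
pose r u j := rank M (e u * en j + b u).
have rM u v j : r (u * v)%g j = r u (r v j).
  rewrite /r rankK; last exact: Minv.
  by congr rank; rewrite eM bM; lia.
have r1 j : r 1%g j = j.
  have e11 : e 1%g = 1.
    by have := eM 1%g 1%g; rewrite mulg1; case: (e1 1%g) => ->.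
  have b1 : b 1%g = 0 by have := bM 1%g 1%g; rewrite mulg1 e11; lia.
  by rewrite /r e11 b1 mul1r addr0 enK.
have rK u : cancel (r u) (r u^-1%g) by move=> j; rewrite -rM mulVg r1.
have rVK u : cancel (r u^-1%g) (r u) by move=> j; rewrite -rM mulgV r1.
have expand u : forall x y : int, zdist x y <= zdist (r u x) (r u y).
  apply: (monotone_expands (e1 u)) => i j /en_lt ij; rewrite /r.
  have := @rank_lt M (e u * en i + b u) (e u * en j + b u) (Minv _ _ (Men i)).
  have := @rank_lt M (e u * en j + b u) (e u * en i + b u) (Minv _ _ (Men j)).
  by case: (e1 u) => ->; lia.
exists r; split; last by move=> u m Mm; rewrite /r rankK.
split; first by split=> // u; exists (r u^-1%g).
move=> u x y; apply/eqP; rewrite eq_le expand andbT.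
by have := expand u^-1%g (r u x) (r u y); rewrite !rK.
Qed.

(** * Real constants *)

Lemma coarse_of_quasi_isometry (R : realType) (L A : R) :
  1 <= L -> 0 <= A -> exists c : int, 1 <= c
    /\ forall u, quasi_isometry L A u -> coarse c u.
Proof.
move=> L1 A0; pose c := Num.Def.archi_bound (L + A + L * A).
have LA0 : 0 <= L * A by apply: mulr_ge0 => //; lra.
have cP : L + A + L * A < c%:R by apply: archi_boundP; lra.
exists c%:Z; split.
  by rewrite -(ler_int R) -pmulrn; lra.
move=> u qu x y; have [lo hi] := qu x y.
have d0 : 0 <= (zdist x y)%:~R :> R by rewrite ler0z normr_ge0.
have d0' : 0 <= (zdist (u x) (u y))%:~R :> R by rewrite ler0z normr_ge0.
have L0 : 0 < L by lra.
have lo' : (zdist x y)%:~R <= L * (zdist (u x) (u y))%:~R + L * A.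
  by rewrite -mulrDr -ler_pdivrMl // -lerBlDr.
split; rewrite -(ler_int R) rmorphM rmorphD /= -pmulrn.
- have : L * (zdist x y)%:~R <= c%:R * (zdist x y)%:~R by apply: ler_wpM2r; lra.
  by rewrite mulrDr mulr1; lra.
- have : L * (zdist (u x) (u y))%:~R <= c%:R * (zdist (u x) (u y))%:~R.
    by apply: ler_wpM2r; lra.
  by rewrite mulrDr mulr1; lra.
Qed.

Lemma quasi_isometry_int (R : realType) (l a : int) (f : int -> int) : 1 <= l ->
  (forall x y : int, zdist (f x) (f y) <= l * zdist x y + a
                     /\ zdist x y <= l * (zdist (f x) (f y) + a)) ->
  quasi_isometry (l%:~R : R) a%:~R f.
Proof.
move=> l1 fP x y; have [hi lo] := fP x y.
have l0 : 0 < l%:~R :> R by rewrite ltr0z; lia.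
split; last by rewrite -intrM -intrD ler_int.
by rewrite lerBlDr ler_pdivrMl // -intrD -intrM ler_int.
Qed.

Theorem proposition1p13 (R : realType) (L A : R) (hL : 1 <= L) (hA : 0 <= A) :
  exists L' A' : R,
    1 <= L' /\ 0 <= A'
    /\ forall (U : groupType) (rho0 : U -> int -> int),
         quasi_isometric_action L A rho0 ->
         exists (rho1 : U -> int -> int) (f : int -> int),
           isometric_action rho1
           /\ surjective f
           /\ quasi_isometry L' A' f
           /\ forall (u : U) (n : int), f (rho0 u n) = rho1 u (f n).
Proof.
have [c [c1 cP]] := coarse_of_quasi_isometry hL hA.
have := coarse_gap_ge0 c1; move KE: (coarse_gap c) => K K0.
(* Every interval of D integers will contain a value of F. *)
pose D : int := 8 * K + 5.
exists D%:~R, (8 * K + 1)%:~R; split; first by rewrite ler1z /D; lia.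
split; first by rewrite ler0z; lia.
move=> U rho0 [arho qrho].
have [e [b [e1 eM bM near]]] :=
  near_isometric_action c1 arho (fun u => cP _ (qrho u)).
rewrite KE in near.
have [F [Feq Fnear]] := equivariant_midrange arho e1 eM bM near.
pose M y := `[< exists x, F x = y >].
have MF x : M (F x) by apply/asboolP; exists x.
have Mdense (y : int) : exists m : int, M m /\ y <= m < y + D.
  (* The first multiple of 4 beyond y + 4 * K: then F x, being within 4 * K of
     4 * x, lies between y and y + 8 * K + 4. *)
  pose x := ((y + 4 * K) %/ 4)%Z + 1.
  exists (F x); split=> //; have := Fnear x; rewrite /x /D; lia.
have D1 : 1 <= D by rewrite /D; lia.
have [||| rho1 [iso1 eq1]] :=
  @collapse_action D U M e (fun u => 2 * b u) D1 Mdense e1.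
- by move=> u m /asboolP[x <-]; rewrite -Feq.
- exact: eM.
- by move=> u v; rewrite bM; lia.
exists rho1, (rank M \o F); split=> //; split; last split.
- move=> j; have [m [/asboolP[x <-] mj]] := rank_onto D1 Mdense j.
  by exists x.
- apply: quasi_isometry_int => // x y; rewrite /zdist /=.
  have := Fnear x; have := Fnear y; have [le|/ltW le] := leP (F x) (F y);
    have := rank_le M le; have := rank_expand D1 Mdense le;
    by split; rewrite /D in D1 *; nia.
- by move=> u n /=; rewrite Feq eq1.
Qed.
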